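(* Let $0<s<1$, $a=1-2s$, and let $U\in H^1(B_1^*,y^adX)$ be a weak solution to $$\begin{cases}\operatorname{div}(y^{a}B(x)\nabla U)=\operatorname{div}(y^aF),&\text{in } B_1^*,\\ -y^{a}U_y\big|_{y=0}=f,&\text{on } B_1,\end{cases}$$ where $F=(F_1,\ldots,F_{n+1})$ is a vector field on $B_1^*$ with $F_i\in L^2(B_1^*,y^adX)$ for $i=1,\ldots,n$ and $F_{n+1}=0$. Then, for every $\eta\in C^\infty(\overline{B_1^*})$ that vanishes on $\partial B_1^*\setminus(\overline{B_1}\times\{0\})$, $$\int_{B_1^*}y^{a}\eta^2|\nabla U|^2\,dX\leq C\left(\int_{B_1^*}y^{a}\left(|\nabla\eta|^2U^2+|F|^2\eta^2\right)dX+\int_{B_1}(\eta(x,0))^2|U(x,0)||f(x)|\,dx\right),$$ where $C$ depends only on the ellipticity constants.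
   Context: $B_1=\{x\in\mathbb{R}^n:|x|<1\}$, $B_1^*=B_1\times(0,1)\subset\mathbb{R}^{n+1}$, $X=(x,y)$; $\nabla$ and $\operatorname{div}$ are taken in $X$. $B(x)=\begin{pmatrix}A(x)&0\\0&1\end{pmatrix}$, where $A(x)$ is a symmetric $n\times n$ matrix of bounded measurable functions with $\Lambda_1|\xi|^2\le A(x)\xi\cdot\xi\le\Lambda_2|\xi|^2$ for all $\xi\in\mathbb{R}^n$ and a.e. $x$, $0<\Lambda_1\le\Lambda_2$ (ellipticity constants). $H^1(B_1^*,y^adX)$ is the weighted Sobolev space with norm squared $\int_{B_1^*}y^a(U^2+|\nabla U|^2)\,dX$, and $U(\cdot,0)$ is the trace. $f$ is a measurable function on $B_1$ for which the integrals below make sense. $U$ is a weak solution if $$\int_{B_1^*}y^{a}B(x)\nabla U\cdot\nabla\psi\,dX=\int_{B_1^*}y^{a}F\cdot\nabla\psi\,dX+\int_{B_1}\psi(x,0)f(x)\,dx$$ for every $\psi\in H^1(B_1^*,y^adX)$ such that $\psi=0$ on $\partial B_1^*\setminus(\overline{B_1}\times\{0\})$. *)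

(* Defs.v *)
From HB Require Import structures.
From mathcomp Require Import all_boot all_order all_algebra.
From mathcomp Require Import all_classical all_reals all_analysis.

Set Implicit Arguments.
Unset Strict Implicit.
Unset Printing Implicit Defensive.
Import Order.TTheory GRing.Theory Num.Theory.
Import numFieldNormedType.Exports.

Local Open Scope classical_set_scope.
Local Open Scope ring_scope.

(* The sigma-algebra on R^n generated by the coordinate functions, as the
   library does for n.-tuple; it is the Borel sigma-algebra. *)
Section rV_measurable.
Variables (R : realType) (n : nat).

Let coord (i : 'I_n) (x : 'rV[R]_n) : R := x ord0 i.

Let rV_set0 : g_sigma_preimage coord set0.
Proof. exact: sigma_algebra0. Qed.

Let rV_setC A : g_sigma_preimage coord A -> g_sigma_preimage coord (~` A).
Proof. exact: sigma_algebraC. Qed.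

Let rV_bigcup (F : _^nat) : (forall i, g_sigma_preimage coord (F i)) ->
  g_sigma_preimage coord (\bigcup_i (F i)).
Proof. exact: sigma_algebra_bigcup. Qed.

HB.instance Definition _ := @isMeasurable.Build default_measure_display
  'rV[R]_n (g_sigma_preimage coord) rV_set0 rV_setC rV_bigcup.

Lemma measurable_coord (i : 'I_n) :
  measurable_fun [set: 'rV[R]_n] (fun x : 'rV[R]_n => x ord0 i).
Proof.
move=> _ Y mY; rewrite setTI; apply: sub_sigma_algebra => /=.
rewrite -bigcup_seq/=; exists i => /=; first by rewrite mem_index_enum.
by exists Y => //; rewrite setTI.
Qed.

Lemma measurable_fun_rV d (T : measurableType d) (f : T -> 'rV[R]_n) :
  (forall i, measurable_fun [set: T] (fun t => f t ord0 i)) ->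
  measurable_fun [set: T] f.
Proof.
move=> mf.
suff H : g_sigma_preimage (fun i => coord i \o f) `<=` measurable.
  move=> _ A mA; apply: H; rewrite g_sigma_preimage_comp.
  by exists A.
apply: smallest_sub; first exact: sigma_algebra_measurable.
rewrite -bigcup_seq/=; apply: bigcup_sub => i _ A [B mB <-].
exact: mf.
Qed.

End rV_measurable.

(* Lebesgue measure on R^n, by recursion on n from the product measure on
   R x R^n; on R^0 it is the unit mass. *)
Section lebesgue_rV.
Variable R : realType.

Definition cons_rV n (p : R * 'rV[R]_n) : 'rV[R]_n.+1 :=
  \row_i if unlift ord0 i is Some j then p.2 ord0 j else p.1.

Definition uncons_rV n (x : 'rV[R]_n.+1) : R * 'rV[R]_n :=
  (x ord0 ord0, \row_i x ord0 (lift ord0 i)).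

Lemma cons_rV0 n p : @cons_rV n p ord0 ord0 = p.1.
Proof. by rewrite mxE unlift_none. Qed.

Lemma cons_rVS n p (i : 'I_n) : @cons_rV n p ord0 (lift ord0 i) = p.2 ord0 i.
Proof. by rewrite mxE liftK. Qed.

Lemma cons_rVK n : cancel (@cons_rV n) (@uncons_rV n).
Proof.
move=> [x v]; rewrite /uncons_rV cons_rV0; congr pair.
by apply/rowP => i; rewrite mxE cons_rVS.
Qed.

Lemma measurable_cons_rV n : measurable_fun setT (@cons_rV n).
Proof.
apply: measurable_fun_rV => i; have [j ->|->] := unliftP ord0 i.
  under eq_fun do rewrite cons_rVS.
  exact: (measurableT_comp (f := fun x : 'rV[R]_n => x ord0 j)
    (measurable_coord j) measurable_snd).
under eq_fun do rewrite cons_rV0.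
exact: measurable_fst.
Qed.

Lemma measurable_uncons_rV n : measurable_fun setT (@uncons_rV n).
Proof.
apply/measurable_fun_pairP; split; first exact: measurable_coord.
apply: measurable_fun_rV => i; under eq_fun do rewrite /= mxE.
exact: measurable_coord.
Qed.

Section lebesgue_cons.
Local Open Scope ereal_scope.
Variables (n : nat) (m : {sigma_finite_measure set 'rV[R]_n -> \bar R}).

Definition lebesgue_cons : set 'rV[R]_n.+1 -> \bar R :=
  pushforward (@lebesgue_measure R \x m) (@cons_rV n).

Let lebesgue_cons0 : lebesgue_cons set0 = 0.
Proof. by rewrite /lebesgue_cons /pushforward preimage_set0 measure0. Qed.

Let lebesgue_cons_ge0 A : 0 <= lebesgue_cons A.
Proof. by rewrite /lebesgue_cons /pushforward measure_ge0. Qed.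

Let lebesgue_cons_sigma_additive : semi_sigma_additive lebesgue_cons.
Proof.
move=> F mF tF mUF; rewrite /lebesgue_cons /pushforward preimage_bigcup.
have mp A : measurable A -> measurable (@cons_rV n @^-1` A).
  by move=> mA; rewrite -[X in measurable X]setTI; exact: measurable_cons_rV.
apply: measure_semi_sigma_additive.
- by move=> k; exact: mp.
- apply/trivIsetP => i j _ _ ij; rewrite -preimage_setI.
  by move/trivIsetP : tF => /(_ _ _ _ _ ij) ->//; rewrite preimage_set0.
- by rewrite -preimage_bigcup; exact: mp.
Qed.

HB.instance Definition _ := isMeasure.Build _ _ _ lebesgue_cons
  lebesgue_cons0 lebesgue_cons_ge0 lebesgue_cons_sigma_additive.

Let lebesgue_cons_sigma_finite : sigma_finite setT lebesgue_cons.
Proof.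
have /sigma_finiteP[F [TF ndF Foo]] := sigma_finiteT (@lebesgue_measure R).
have /sigma_finiteP[G [TG ndG Goo]] := sigma_finiteT m.
exists (fun k => @uncons_rV n @^-1` (F k `*` G k)).
  rewrite -preimage_bigcup -(preimage_setT (@uncons_rV n)); congr (_ @^-1` _).
  rewrite -setXTT TF TG predeqE => -[x y]; split=> [|[k _ []/= ? ?]].
    move=> [/= [k _ Fkx] [l _ Gly]]; exists (maxn k l) => //; split.
    - by move: x Fkx; exact/subsetPset/ndF/leq_maxl.
    - by move: y Gly; exact/subsetPset/ndG/leq_maxr.
  by split; exists k.
move=> k; have [mFk Fkoo] := Foo k; have [mGk Gkoo] := Goo k.
split.
  rewrite -[X in measurable X]setTI; apply: measurable_uncons_rV => //.
  exact: measurableX.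
rewrite /lebesgue_cons /pushforward -comp_preimage.
rewrite (_ : _ \o _ = id); last by apply/funext => p /=; rewrite cons_rVK.
by rewrite preimage_id product_measure1E// lte_mul_pinfty// ge0_fin_numE.
Qed.

HB.instance Definition _ := @Measure_isSigmaFinite.Build _ _ _ lebesgue_cons
  lebesgue_cons_sigma_finite.

End lebesgue_cons.

Fixpoint lebesgue_rV n : {sigma_finite_measure set 'rV[R]_n -> \bar R} :=
  match n with
  | 0 => [the {sigma_finite_measure set _ -> \bar R} of \d_(0 : 'rV[R]_0)]
  | n.+1 => [the {sigma_finite_measure set _ -> \bar R} of
              lebesgue_cons (lebesgue_rV n)]
  end.

Lemma lebesgue_rV_box n (A : 'I_n -> set R) :
  (forall i, measurable (A i)) ->
  (lebesgue_rV n [set x | forall i, A i (x ord0 i)] =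
   \prod_(i < n) lebesgue_measure (A i))%E.
Proof.
elim: n A => [|n IH] A mA.
  rewrite big_ord0 /= diracE mem_set//; by case.
have mbox : measurable [set x : 'rV[R]_n | forall i, A (lift ord0 i) (x ord0 i)].
  rewrite (_ : mkset _ = \bigcap_(i in [set: 'I_n])
    ((fun x : 'rV[R]_n => x ord0 i) @^-1` A (lift ord0 i))); last first.
    by apply/seteqP; split=> x /= h i => [_|]; exact: h.
  apply: fin_bigcap_measurable => // i _.
  by rewrite -[X in measurable X]setTI; exact: measurable_coord.
rewrite big_ord_recl -IH//= -product_measure1E//; last exact: mA.
rewrite /lebesgue_cons /pushforward; congr (_ _).
apply/seteqP; split=> [p /= h|p /= [h0 h] i].
  by split=> [|i]; [rewrite -(cons_rV0 p)|rewrite -(cons_rVS p)]; exact: h.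
have [j ->|->] := unliftP ord0 i; first by rewrite cons_rVS; exact: h.
by rewrite cons_rV0.
Qed.

End lebesgue_rV.

Section euclidean.
Variable R : realType.
Implicit Types m n : nat.

Definition dotv m (u v : 'rV[R]_m) : R := \sum_(i < m) u ord0 i * v ord0 i.

(* The library norm on 'rV[R]_m is the sup norm. *)
Definition enorm m (u : 'rV[R]_m) : R := Num.sqrt (dotv u u).

Definition mulmv m (M : 'M[R]_m) (v : 'rV[R]_m) : 'rV[R]_m := (M *m v^T)^T.

Definition unit_ball n : set 'rV[R]_n := [set x | enorm x < 1].

(* A point X = (x, y) of R^(n+1) is the row vector X = row_mx x y%:M. *)
Definition xpart n (X : 'rV[R]_(n + 1)) : 'rV[R]_n := lsubmx X.
Definition ypart n (X : 'rV[R]_(n + 1)) : R := rsubmx X ord0 ord0.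
Definition base_point n (x : 'rV[R]_n) : 'rV[R]_(n + 1) := row_mx x 0.

Definition half_cylinder n : set 'rV[R]_(n + 1) :=
  [set X | unit_ball (xpart X) /\ 0 < ypart X < 1].

Definition closed_base n : set 'rV[R]_(n + 1) :=
  [set X | closure (@unit_ball n) (xpart X) /\ ypart X = 0].

Definition outer_boundary n : set 'rV[R]_(n + 1) :=
  (closure (@half_cylinder n) `\` interior (@half_cylinder n))
    `\` @closed_base n.

Definition gradient m (f : 'rV[R]_m -> R) (X : 'rV[R]_m) : 'rV[R]_m :=
  \row_i 'D_(delta_mx ord0 i) f X.

(* C^oo: all iterated directional derivatives exist and are continuous. *)
Definition smooth m (f : 'rV[R]_m -> R) :=
  forall vs : seq 'rV[R]_m,
    let g := foldr (fun v h => 'D_v h) f vs in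
    continuous g /\ forall X v, derivable g X v.

(* C^oo of a closed set: restrictions of smooth functions on the space. *)
Definition smooth_on m (D : set 'rV[R]_m) (f : 'rV[R]_m -> R) :=
  exists2 g, smooth g & {in D, f =1 g}.

Definition test_function m (D : set 'rV[R]_m) (f : 'rV[R]_m -> R) :=
  smooth f /\
  exists K, [/\ compact K, K `<=` D & forall X, ~ K X -> f X = 0].

End euclidean.

Arguments unit_ball {R} n.
Arguments half_cylinder {R} n.
Arguments closed_base {R} n.
Arguments outer_boundary {R} n.

Section weighted_sobolev.
Variables (R : realType) (n : nat) (a : R).

Local Notation Rn := 'rV[R]_n.
Local Notation Rn1 := 'rV[R]_(n + 1).
Local Notation dx := (lebesgue_rV R n).
Local Notation dX := (lebesgue_rV R (n + 1)).
Local Notation B1 := (@unit_ball R n).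
Local Notation B1s := (@half_cylinder R n).

Implicit Types (U : Rn1 -> R) (DU F : Rn1 -> Rn1).

Definition weighted_L2 (u : Rn1 -> R) :=
  measurable_fun B1s u /\
  (\int[dX]_(X in B1s) (ypart X `^ a * u X ^+ 2)%:E < +oo)%E.

Definition weak_gradient U DU :=
  forall phi, test_function B1s phi -> forall i : 'I_(n + 1),
    \int[dX]_(X in B1s) (U X * gradient phi X ord0 i) =
    - \int[dX]_(X in B1s) (DU X ord0 i * phi X).

(* The weak gradient is carried explicitly: it is unique up to a null set. *)
Definition in_H1 U DU :=
  [/\ weighted_L2 U, forall i, weighted_L2 (fun X => DU X ord0 i)
    & weak_gradient U DU].

(* phi_k --> U in H^1(B_1^*, y^a dX), for functions phi_k smooth up to the
   boundary. *)
Definition cvg_H1 (phi : nat -> Rn1 -> R) U DU :=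
  (forall k, smooth_on (closure B1s) (phi k)) /\
  (\int[dX]_(X in B1s) (ypart X `^ a *
     ((phi k X - U X) ^+ 2 + enorm (gradient (phi k) X - DU X) ^+ 2))%:E
     @[k --> \oo] --> 0)%E.

(* u0 is the trace U(., 0): the trace operator is the continuous extension to
   H^1 of the restriction of smooth functions to y = 0. *)
Definition is_trace U DU (u0 : Rn -> R) :=
  measurable_fun B1 u0 /\
  exists2 phi, cvg_H1 phi U DU &
    (\int[dx]_(x in B1) ((phi k (base_point x) - u0 x) ^+ 2)%:E
       @[k --> \oo] --> 0)%E.

(* U = 0 on the outer boundary, in the sense of H^1: U is a limit of smooth
   functions that vanish there. *)
Definition zero_on_outer_boundary U DU :=
  exists2 phi, cvg_H1 phi U DU &
    forall k X, outer_boundary n X -> phi k X = 0.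

Definition block_matrix (A : Rn -> 'M[R]_n) (x : Rn) : 'M[R]_(n + 1) :=
  block_mx (A x) 0 0 1%:M.

(* The identity only makes sense when psi(., 0) f is integrable, so this is
   part of the definition; the two other integrands are integrable by the
   Cauchy-Schwarz inequality. *)
Definition weak_solution (A : Rn -> 'M[R]_n) F (f : Rn -> R) U DU :=
  in_H1 U DU /\
  forall psi Dpsi psi0,
    in_H1 psi Dpsi -> zero_on_outer_boundary psi Dpsi ->
    is_trace psi Dpsi psi0 ->
    dx.-integrable B1 (EFin \o (fun x => psi0 x * f x)) /\
    \int[dX]_(X in B1s) (ypart X `^ a *
        dotv (mulmv (block_matrix A (xpart X)) (DU X)) (Dpsi X)) =
    \int[dX]_(X in B1s) (ypart X `^ a * dotv (F X) (Dpsi X)) +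
    \int[dx]_(x in B1) (psi0 x * f x).

End weighted_sobolev.

Definition elliptic_matrix (R : realType) (n : nat) (L1 L2 : R)
    (A : 'rV[R]_n -> 'M[R]_n) :=
  [/\ forall x, unit_ball n x -> (A x)^T = A x,
      forall i j, measurable_fun (unit_ball n) (fun x => A x i j),
      exists M : R, forall x, unit_ball n x -> forall i j, `|A x i j| <= M
    & {ae lebesgue_rV R n, forall x, unit_ball n x -> forall xi : 'rV[R]_n,
        L1 * enorm xi ^+ 2 <= dotv (mulmv (A x) xi) xi <= L2 * enorm xi ^+ 2}].

(* Main.v *)
(* Test the equation with [eta^2 U].  With [v = eta DU], [w = U grad eta],
   [G = eta F] and [b(., .)] the bilinear form of the block matrix, it becomes
     int y^a b(v, v + 2 w) = int y^a G.(v + 2 w) + int eta^2 U f,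
   and, almost everywhere, ellipticity absorbs the cross terms:
     b(v, v + 2 w) - G.(v + 2 w) >= c |v|^2 - K (|w|^2 + |G|^2).
   That [eta^2 U] is an admissible test function is seen by multiplying the smooth
   approximations of [U] by [eta^2]; the same sequence yields the vanishing on the
   outer boundary and the trace. *)
Require Import Defs.
From mathcomp Require Import all_boot all_order all_algebra.
From mathcomp Require Import all_classical all_reals all_analysis.
From mathcomp Require Import measurable_realfun ring lra.
Import Order.TTheory GRing.Theory Num.Theory.
Import numFieldNormedType.Exports.
Local Open Scope classical_set_scope.
Local Open Scope ring_scope.
Set Implicit Arguments.
Unset Strict Implicit.
Unset Printing Implicit Defensive.

(** * Topology and measurability on R^n *)

Section topology_rV.
Context {R : realType} {n : nat}.
Implicit Types (O K : set 'rV[R]_n) (f g : 'rV[R]_n -> R).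

(** Two obstacles shape the proof. The integrals in [weak_gradient] carry no weight, whereas [U] and
    [DU] are controlled only with the weight [y^a]. Since [a <= 1], one has [y <= y^a] on the
    cylinder, so the weight is bounded below on the support of a test function, and the product rule
    for [eta^2 U] can be verified by integration against it. Secondly, the real-valued integral is
    linear only on integrable functions, so every term, including the one to be absorbed, is shown
    to be integrable before the tested identity is rearranged.

    The constants come from the block matrix: its ellipticity constants are [l = min (L1, 1)] and
    [L = max (L2, 1)]. Then [c = l / 4], [K = 2 L + 2 + 1 / l] and [C = K / c], in which neither the
    dimension nor [a] occurs. *)

Lemma measurable_cube (q : 'rV[R]_n) (r : R) : 0 < r ->
  measurable [set X : 'rV[R]_n | forall i, `|q ord0 i - X ord0 i| < r].
Proof.
move=> r0; rewrite (_ : mkset _ = \bigcap_(i in [set: 'I_n])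
  ((fun X : 'rV[R]_n => X ord0 i) @^-1` ball (q ord0 i) r)); last first.
  by apply/seteqP; split => X /= h i => [_|]; exact: h.
apply: fin_bigcap_measurable => // i _.
rewrite -[X in measurable X]setTI; apply: measurable_coord => //.
apply: open_measurable; exact: ball_open.
Qed.

(** The sigma-algebra is generated by the coordinates, so openness is converted into a countable
    union: that of the cubes with rational centre and half-side [1 / (k + 1)] that lie in [O]. *)
Lemma open_measurable_rV O : open O -> measurable O.
Proof.
move=> oO.
pose cube (p : 'rV[rat]_n * nat) := [set X : 'rV[R]_n |
  forall i, `|(map_mx (ratr : rat -> R) p.1) ord0 i - X ord0 i| < p.2.+1%:R^-1].
pose cubeO p := if `[< cube p `<=` O >] then cube p else set0.
suff -> : O = \bigcup_p cubeO p.
  apply: countable_bigcupT_measurable; first exact: countableP.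
  move=> p; rewrite /cubeO; case: asboolP => // _.
  by apply: measurable_cube; rewrite invr_gt0.
apply/seteqP; split => [X OX|X [p _]]; last first.
  by rewrite /cubeO; case: asboolP => // + ?; exact.
have /nbhs_ballP[e /= e0 eO] := open_nbhs_nbhs (conj oO OX).
(* Half of [e] suffices because a point of the cube is compared with [X] through the rational
   centre. *)
have [k ke] : exists k, k.+1%:R^-1 < e / 2.
  have /ltr_add_invr[k] : 0 < e / 2 by rewrite divr_gt0.
  by rewrite add0r => ?; exists k.
have k0 : 0 < k.+1%:R^-1 :> R by rewrite invr_gt0.
have /choice[q qX] : forall i, exists q : rat,
    ratr q \in `]X ord0 i - k.+1%:R^-1, X ord0 i + k.+1%:R^-1[.
  by move=> i; apply: rat_in_itvoo; rewrite ltrD2l gtrN.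
have Xq : cube (\row_i q i, k) X.
  move=> i; rewrite !mxE; have := qX i; rewrite in_itv/= => /andP[? ?].
  by rewrite distrC ltr_distlC; apply/andP; split.
exists (\row_i q i, k) => //; rewrite /cubeO asboolT// => Y Yq.
apply: eO; split => // i j; rewrite (ord1 i) /ball/=.
rewrite (splitr e).
apply: (le_lt_trans (ler_distD ((map_mx ratr (\row_i q i) : 'rV[R]_n) ord0 j) _ _)).
apply: ltrD; last exact: lt_trans (Yq j) ke.
by rewrite distrC; exact: lt_trans (Xq j) ke.
Qed.

Lemma continuous_measurable_rV f : continuous f -> measurable_fun setT f.
Proof.
move=> /continuousP cf; apply: (measurability _ (RGenOpens.measurableE R)).
move=> _ [_ [a [b ->] <-]]; rewrite setTI; apply: open_measurable_rV.
by apply: cf; exact: interval_open.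
Qed.

Lemma continuous_compact_bounded K f : continuous f -> compact K ->
  exists2 M, 0 <= M & forall X, K X -> `|f X| <= M.
Proof.
move=> cf cK.
have /compact_bounded[M [_ KM]] : compact (f @` K).
  by apply: continuous_compact => //; exact: continuous_subspaceT.
exists (`|M| + 1) => [|X KX]; first by rewrite addr_ge0.
by apply: KM; [rewrite (le_lt_trans (ler_norm M))// ltrDl|exists X].
Qed.

Lemma dotv_continuous : continuous (fun X : 'rV[R]_n => dotv X X).
Proof.
apply: continuous_big => [|i _]; first exact: add_continuous.
by move=> X; apply: continuousM; exact: coord_continuous.
Qed.

Lemma enorm2 (u : 'rV[R]_n) : enorm u ^+ 2 = dotv u u.
Proof. by rewrite sqr_sqrtr// sumr_ge0// => i _; rewrite -expr2 sqr_ge0. Qed.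

Lemma enorm_lt1 (u : 'rV[R]_n) : (enorm u < 1) = (dotv u u < 1).
Proof. by rewrite -enorm2 expr_lt1// sqrtr_ge0. Qed.

Lemma open_unit_ball : open (unit_ball n : set 'rV[R]_n).
Proof.
rewrite (_ : unit_ball n = (fun X : 'rV[R]_n => dotv X X) @^-1` [set r | r < 1]).
  apply: open_comp; last exact: open_lt.
  by move=> X _; exact: dotv_continuous.
by apply/seteqP; split => X /=; rewrite /unit_ball/= enorm_lt1.
Qed.

Lemma measurable_unit_ball : measurable (unit_ball n : set 'rV[R]_n).
Proof. apply: open_measurable_rV; exact: open_unit_ball. Qed.

Lemma unit_ball_coord (u : 'rV[R]_n) i : unit_ball n u -> `|u ord0 i| < 1.
Proof.
rewrite /unit_ball/= enorm_lt1 => u1.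
rewrite -(expr_lt1 (n:=2))// -normrX ger0_norm ?sqr_ge0//.
apply: le_lt_trans u1; rewrite /dotv (bigD1 i)//= -expr2 lerDl.
by rewrite sumr_ge0// => j _; rewrite -expr2 sqr_ge0.
Qed.

End topology_rV.

(** * Smooth functions and the half cylinder *)

Section smooth_functions.
Context {R : realType} {m : nat}.
Implicit Types (f g : 'rV[R]_m -> R) (vs : seq 'rV[R]_m).

Local Notation iter_derive f vs := (foldr (fun v h => 'D_v h) f vs).

Definition continuously_derivable f :=
  continuous f /\ forall X v, derivable f X v.

(** Bounding the order makes the product rule amenable to induction: differentiating a product once
    leaves products of factors of order one less. *)
Definition smooth_upto k f :=
  forall vs, (size vs <= k)%N -> continuously_derivable (iter_derive f vs).

Lemma smooth_uptoP f : smooth f <-> forall k, smooth_upto k f.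
Proof.
by split=> [sf k vs _|sf vs]; [exact: sf|exact: (sf (size vs))].
Qed.

Lemma continuously_derivableD f g : continuously_derivable f ->
  continuously_derivable g -> continuously_derivable (f + g).
Proof.
move=> [cf df] [cg dg]; split => [X|X v]; last exact: derivableD.
by apply: continuousD; [exact: cf|exact: cg].
Qed.

Lemma continuously_derivableM f g : continuously_derivable f ->
  continuously_derivable g -> continuously_derivable (f * g).
Proof.
move=> [cf df] [cg dg]; split => [X|X v]; last exact: derivableM.
by apply: continuousM; [exact: cf|exact: cg].
Qed.

Lemma smooth_uptoD k f g :
  smooth_upto k f -> smooth_upto k g -> smooth_upto k (f + g).
Proof.
move=> sf sg vs vsk.
suff -> : iter_derive (f + g) vs = iter_derive f vs + iter_derive g vs.
  by apply: continuously_derivableD; [exact: sf|exact: sg].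
elim: vs vsk => //= v vs IH /ltnW vsk.
rewrite IH//; apply/funext => X; rewrite deriveD//.
- by have [_] := sf _ vsk; exact.
- by have [_] := sg _ vsk; exact.
Qed.

Lemma smooth_upto_le k l f : (k <= l)%N -> smooth_upto l f -> smooth_upto k f.
Proof. by move=> kl sf vs vsk; apply: sf; exact: leq_trans kl. Qed.

Lemma smooth_upto_derive k f v : smooth_upto k.+1 f -> smooth_upto k ('D_v f).
Proof.
move=> sf vs vsk; have := sf (rcons vs v).
by rewrite size_rcons foldr_rcons; exact.
Qed.

Lemma smooth_uptoM k f g :
  smooth_upto k f -> smooth_upto k g -> smooth_upto k (f * g).
Proof.
elim: k f g => [|k IH] f g sf sg.
  case=> // _; apply: continuously_derivableM.
  - exact: (sf [::]).
  - exact: (sg [::]).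
(* [foldr] applies the last direction first. Splitting it off leaves the other directions acting on
   a sum of two products, to which the induction hypothesis applies. *)
move=> vs; case: (lastP vs) => [_|{}vs v].
  by apply: continuously_derivableM; [exact: (sf [::])|exact: (sg [::])].
rewrite size_rcons foldr_rcons => vsk.
have -> : 'D_v (f * g) = f * 'D_v g + g * 'D_v f.
  apply/funext => X; rewrite deriveM//.
  - by have [_] := sf [::] isT; exact.
  - by have [_] := sg [::] isT; exact.
apply: (@smooth_uptoD k) => //.
- by apply: IH; [exact: smooth_upto_le sf|exact: smooth_upto_derive].
- by apply: IH; [exact: smooth_upto_le sg|exact: smooth_upto_derive].
Qed.

Lemma smoothM f g : smooth f -> smooth g -> smooth (f * g).
Proof.
by move=> /smooth_uptoP sf /smooth_uptoP sg; apply/smooth_uptoP => k;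
  exact: smooth_uptoM.
Qed.

Lemma smooth_continuous f : smooth f -> continuous f.
Proof. by case/(_ [::]). Qed.

Lemma smooth_derivable f X v : smooth f -> derivable f X v.
Proof. by case/(_ [::]) => _; exact. Qed.

Lemma gradient_continuous f i : smooth f ->
  continuous (fun X => gradient f X ord0 i).
Proof.
move=> sf; rewrite (_ : (fun X => _) = 'D_(delta_mx ord0 i) f).
  by have [] := sf [:: delta_mx ord0 i].
by apply/funext => X; rewrite mxE.
Qed.

Lemma gradientM f g X : smooth f -> smooth g ->
  gradient (f * g) X = f X *: gradient g X + g X *: gradient f X.
Proof.
move=> sf sg; apply/rowP => i; rewrite !mxE deriveM//; exact: smooth_derivable.
Qed.

Lemma near_eq_gradient f g X :
  (\near X, f X = g X) -> gradient f X = gradient g X.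
Proof. by move=> fg; apply/rowP => i; rewrite !mxE; exact: near_eq_derive. Qed.

Lemma gradient_eq_open (D : set 'rV[R]_m) f g : open D -> {in D, f =1 g} ->
  forall X, D X -> gradient f X = gradient g X.
Proof.
move=> oD fg X DX; apply: near_eq_gradient.
have : nbhs X D by apply: open_nbhs_nbhs.
by apply: filterS => Y DY; apply: fg; rewrite inE.
Qed.

End smooth_functions.

Section half_cylinder.
Context {R : realType} {n : nat}.
Local Notation Rn := 'rV[R]_n.
Local Notation Rn1 := 'rV[R]_(n + 1).

Lemma xpartE (X : Rn1) i : xpart X ord0 i = X ord0 (lshift 1 i).
Proof. by rewrite mxE. Qed.

Lemma ypartE (X : Rn1) : ypart X = X ord0 (rshift n ord0).
Proof. by rewrite /ypart mxE. Qed.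

Lemma xpart_continuous : continuous (@xpart R n).
Proof.
move=> X B /nbhs_ballP[e /= e0 eB]; apply/nbhs_ballP; exists e => //= Y [_ XY].
by apply: eB; split => // i j; rewrite !mxE; exact: XY.
Qed.

Lemma ypart_continuous : continuous (@ypart R n).
Proof.
rewrite (_ : @ypart R n = fun X : Rn1 => X ord0 (rshift n ord0)).
  by move=> X; exact: coord_continuous.
by apply/funext => X; rewrite ypartE.
Qed.

Lemma measurable_xpart : measurable_fun setT (@xpart R n).
Proof.
apply: measurable_fun_rV => i; under eq_fun do rewrite xpartE.
exact: measurable_coord.
Qed.

Lemma measurable_ypart : measurable_fun setT (@ypart R n).
Proof. by apply: continuous_measurable_rV; exact: ypart_continuous. Qed.

Lemma measurable_base_point : measurable_fun setT (@base_point R n).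
Proof.
apply: measurable_fun_rV => i; rewrite -(splitK i).
case: (fintype.split i) => j /=.
  by under eq_fun do rewrite row_mxEl; exact: measurable_coord.
by under eq_fun do rewrite row_mxEr mxE; exact: measurable_cst.
Qed.

Lemma open_half_cylinder : open (half_cylinder n : set Rn1).
Proof.
rewrite (_ : half_cylinder n = (@xpart R n @^-1` (unit_ball n)) `&`
  (@ypart R n @^-1` `]0, 1[%classic)).
  apply: openI; apply: open_comp.
  - by move=> X _; exact: xpart_continuous.
  - exact: open_unit_ball.
  - by move=> X _; exact: ypart_continuous.
  - exact: interval_open.
by apply/seteqP; split => X /=; rewrite /half_cylinder/= in_itv.
Qed.

Lemma measurable_half_cylinder : measurable (half_cylinder n : set Rn1).
Proof. by apply: open_measurable_rV; exact: open_half_cylinder. Qed.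

Lemma half_cylinder_coord (X : Rn1) i : half_cylinder n X -> `|X ord0 i| <= 1.
Proof.
move=> [Xx /andP[y0 y1]]; rewrite -(splitK i); case: (fintype.split i) => j /=.
  by rewrite -xpartE ltW// unit_ball_coord.
by rewrite (ord1 j) -ypartE ger0_norm// ltW.
Qed.

Lemma compact_closure_half_cylinder :
  compact (closure (half_cylinder n : set Rn1)).
Proof.
have cC : compact [set v : Rn1 | forall i, (`[-1, 1]%classic : set R) (v ord0 i)].
  by apply: (@rV_compact R _ (fun=> `[-1, 1]%classic)) => _; exact: segment_compact.
apply: (subclosed_compact (@closed_closure _ _) cC).
rewrite [X in _ `<=` X](closure_id _).1.
  apply: closure_subset => X DX i /=; rewrite in_itv/= -ler_norml.
  exact: half_cylinder_coord.
by apply: compact_closed => //; exact: norm_hausdorff.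
Qed.

(** This lets bounds and identities valid on the closed cylinder be used at [y = 0], where traces
    live. *)
Lemma closure_base_point (x : Rn) : unit_ball n x ->
  closure (half_cylinder n) (base_point x).
Proof.
move=> Bx B /nbhs_ballP[e /= e0 eB].
(* The height is below [e], to stay in the ball, and below 1, to stay in the cylinder. *)
pose t := Num.min (e / 2) (2^-1 : R).
have t0 : 0 < t by rewrite lt_min divr_gt0//= invr_gt0.
exists (row_mx x t%:M); split.
  split; first by rewrite /xpart row_mxKl.
  rewrite /ypart row_mxKr mxE eqxx mulr1n t0/= gt_min; apply/orP; right.
  by rewrite invf_lt1// ltr1n.
apply: eB; split => // i j; rewrite (ord1 i) -(splitK j).
case: (fintype.split j) => k /=.
  by rewrite !row_mxEl; exact: ballxx.
rewrite !row_mxEr !mxE (ord1 k) eqxx mulr1n /ball/= sub0r normrN gtr0_norm//.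
by rewrite gt_min ltr_pdivrMr// ltr_pMr// ltr1n.
Qed.

End half_cylinder.

(** * Lebesgue measure on R^n *)

Section lebesgue_rV_facts.
Context {R : realType}.
Local Open Scope ereal_scope.

Lemma lebesgue_half_cylinder_fin n :
  lebesgue_rV R (n + 1) (half_cylinder n) < +oo.
Proof.
pose box := [set X : 'rV[R]_(n + 1) |
  forall i, (`[(-1)%R, 1%R]%classic : set R) (X ord0 i)].
have mbox : measurable box.
  rewrite (_ : box = \bigcap_(i in [set: 'I_(n + 1)])
      ((fun X : 'rV[R]_(n + 1) => X ord0 i) @^-1` `[(-1)%R, 1%R]%classic)); last first.
    by apply/seteqP; split=> X /= h i => [_|]; exact: h.
  apply: fin_bigcap_measurable => // i _.
  by rewrite -[X in measurable X]setTI; exact: measurable_coord.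
apply: (@le_lt_trans _ _ (lebesgue_rV R (n + 1) box)).
  apply: le_measure; rewrite ?inE//; first exact: measurable_half_cylinder.
  by move=> X DX i /=; rewrite in_itv/= -ler_norml; exact: half_cylinder_coord.
rewrite (lebesgue_rV_box (A := fun=> `[(-1)%R, 1%R]%classic))//.
rewrite -ge0_fin_numE; last by apply: prode_ge0 => i _; exact: measure_ge0.
apply: (big_ind (fun x => x \is a fin_num)) => //; first exact: fin_numM.
by move=> i _; rewrite /= lebesgue_measure_itv/=; case: ifP.
Qed.

(** Lebesgue measure is built by splitting off the first coordinate, whereas [y] is the last one;
    this reconciles the two. *)
Lemma xpart_cons_rV n (t : R) (X : 'rV[R]_(n + 1)) :
  xpart (cons_rV (t, X) : 'rV[R]_(n.+1 + 1)) = cons_rV (t, xpart X).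
Proof.
apply/rowP => i; rewrite xpartE; have [j ->|->] := unliftP ord0 i.
  have -> : lshift 1 (lift ord0 j) = lift ord0 (lshift 1 j) :> 'I_(n + 1).+1.
    exact: val_inj.
  by rewrite !cons_rVS /= mxE.
have -> : lshift 1 ord0 = ord0 :> 'I_(n + 1).+1 by exact: val_inj.
by rewrite !cons_rV0.
Qed.

(** Fubini in the first coordinate: almost every section of a null set is null, and the cylinder
    over such a section is null by induction. In dimension 0 the measure is a point mass, so a null
    set is empty. *)
Lemma lebesgue_rV_xpart0 n (N : set 'rV[R]_n) : measurable N ->
  lebesgue_rV R n N = 0 -> lebesgue_rV R (n + 1) (@xpart R n @^-1` N) = 0.
Proof.
elim: n N => [|n IH] N mN N0.
  suff -> : N = set0 by rewrite preimage_set0 measure0.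
  apply/seteqP; split => // x Nx; move: N0.
  rewrite /= diracE (_ : 0%R = x) ?mem_set//; last by apply/rowP => -[].
  by move=> /eqP; rewrite onee_eq0.
have mcons k (B : set 'rV[R]_k.+1) : measurable B ->
    measurable (@cons_rV R k @^-1` B).
  by move=> mB; rewrite -[X in measurable X]setTI; exact: measurable_cons_rV.
have mxpart k (B : set 'rV[R]_k) : measurable B -> measurable (@xpart R k @^-1` B).
  by move=> mB; rewrite -[X in measurable X]setTI; exact: measurable_xpart.
have mQ := mcons _ _ mN.
have mphi := measurable_fun_xsection (lebesgue_rV R n) mQ.
have {}N0 : \int[@lebesgue_measure R]_t
    `|(lebesgue_rV R n \o xsection (@cons_rV R n @^-1` N)) t| = 0.
  by rewrite -[RHS]N0; apply: eq_integral => t _; rewrite gee0_abs.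
have {}N0 := (ae_eq_integral_abs (@lebesgue_measure R) measurableT mphi).1 N0.
(* [n.+1 + 1] computes to [(n + 1).+1], so the measure unfolds to the integral of the measures of
   the sections. *)
have -> : lebesgue_rV R (n.+1 + 1) (@xpart R n.+1 @^-1` N) =
  \int[@lebesgue_measure R]_t (lebesgue_rV R (n + 1)
    (xsection (@cons_rV R (n + 1) @^-1` (@xpart R n.+1 @^-1` N)) t)) by [].
have mP := mcons (n + 1)%N _ (mxpart _ _ mN).
rewrite -[RHS](integral0 (@lebesgue_measure R) setT).
apply: ae_eq_integral => //; first exact: measurable_fun_xsection.
apply: filterS N0 => t /(_ I) Nt _; rewrite -[RHS](IH _ _ Nt); last first.
  exact: measurable_xsection.
congr (lebesgue_rV R (n + 1) _); apply/seteqP; split => X.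
  by rewrite /= !xsectionP /= xpart_cons_rV.
by rewrite /= !xsectionP /= xpart_cons_rV.
Qed.

(* Ellipticity holds for almost every [x]; this transfers it to almost every
   [X = (x, y)]. *)
Lemma ae_xpart n (P : 'rV[R]_n -> Prop) : {ae lebesgue_rV R n, forall x, P x} ->
  {ae lebesgue_rV R (n + 1), forall X, P (xpart X)}.
Proof.
move=> [N [mN N0 PN]]; exists (@xpart R n @^-1` N); split.
- by rewrite -[X in measurable X]setTI; exact: measurable_xpart.
- exact: lebesgue_rV_xpart0.
- by move=> X /= nP; exact: PN.
Qed.

End lebesgue_rV_facts.

(** * Integrability and integrals of real-valued functions *)

Section Rintegral_facts.
Context d (T : measurableType d) (R : realType) (mu : {measure set T -> \bar R}).
Variables (D : set T) (mD : measurable D).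

(** [f] agrees almost everywhere with its absolute value, and [fine] keeps a nonnegative extended
    value nonnegative, even [+oo]. *)
Lemma ae_Rintegral_ge0 (f : T -> R) : measurable_fun D f ->
  {ae mu, forall x, D x -> 0 <= f x} -> 0 <= \int[mu]_(x in D) f x.
Proof.
move=> mf f0; rewrite /Rintegral.
rewrite (ae_eq_integral (fun x => `|f x|%:E))//.
- by apply: fine_ge0; apply: integral_ge0 => x _; rewrite lee_fin.
- exact/measurable_EFinP.
- by apply/measurable_EFinP; exact: measurableT_comp.
- by apply: filterS f0 => x /[apply] fx0; rewrite ger0_norm.
Qed.

Local Notation integrable f := (mu.-integrable D (EFin \o f)).

Lemma rintegrable_measurable (f : T -> R) : integrable f -> measurable_fun D f.
Proof. by move=> /integrableP[/measurable_EFinP]. Qed.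

Lemma rintegrable_le (f g : T -> R) : measurable_fun D f ->
  (forall x, D x -> `|f x| <= g x) -> integrable g -> integrable f.
Proof.
move=> mf fg; apply: le_integrable => //; first exact/measurable_EFinP.
by move=> x Dx; rewrite /= lee_fin (le_trans (fg x Dx))// ler_norm.
Qed.

Lemma rintegrableD (f g : T -> R) : integrable f -> integrable g ->
  integrable (fun x => f x + g x).
Proof. by move=> intf intg; exact: (integrableD mD intf intg). Qed.

Lemma rintegrableB (f g : T -> R) : integrable f -> integrable g ->
  integrable (fun x => f x - g x).
Proof. by move=> intf intg; exact: (integrableB mD intf intg). Qed.

Lemma rintegrableZl (k : R) (f : T -> R) : integrable f ->
  integrable (fun x => k * f x).
Proof. by move=> intf; exact: (integrableZl mD k intf). Qed.

Lemma rintegrable_sum I (s : seq I) (f : I -> T -> R) :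
  (forall i, integrable (f i)) -> integrable (fun x => \sum_(i <- s) f i x).
Proof.
move=> intf; rewrite (_ : EFin \o _ = fun x => (\sum_(i <- s) (f i x)%:E)%E).
  by apply: integrable_sum => // i _; exact: intf.
by apply/funext => x /=; rewrite sumEFin.
Qed.

Lemma ge0_rintegrable (f : T -> R) : measurable_fun D f ->
  (forall x, D x -> 0 <= f x) -> (\int[mu]_(x in D) (f x)%:E < +oo)%E ->
  integrable f.
Proof.
move=> mf f0 foo; apply/integrableP; split; first exact/measurable_EFinP.
rewrite (eq_integral (fun x => (f x)%:E))// => x /set_mem Dx /=.
by rewrite ger0_norm// f0.
Qed.

Lemma rintegrable_fin (f : T -> R) : integrable f ->
  (\int[mu]_(x in D) (f x)%:E = (\int[mu]_(x in D) f x)%:E)%E.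
Proof. by move=> intf; rewrite /Rintegral fineK//; exact: integrable_fin_num. Qed.

Lemma rintegrable_cst (k : R) : (mu D < +oo)%E -> integrable (fun=> k).
Proof.
move=> Doo; apply/integrableP; split; first exact: measurable_cst.
by rewrite /= integral_cst// lte_mul_pinfty.
Qed.

End Rintegral_facts.

(** * The weighted space L^2(y^a dX) *)

Section weighted_L2.
Context {R : realType} {n : nat} (a : R).
Local Notation Rn1 := 'rV[R]_(n + 1).
Local Notation D := (half_cylinder n : set Rn1).
Local Notation mu := (lebesgue_rV R (n + 1)).
Local Notation integrable f := (mu.-integrable D (EFin \o f)).
Implicit Types u v h : Rn1 -> R.

Let mD : measurable D := measurable_half_cylinder.

Lemma measurable_weight : measurable_fun D (fun X => ypart X `^ a).
Proof.
apply: measurable_funTS.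
exact: (measurableT_comp (measurable_powR a) measurable_ypart).
Qed.

Lemma weighted_L2P u : weighted_L2 a u <->
  measurable_fun D u /\ integrable (fun X => ypart X `^ a * u X ^+ 2).
Proof.
split=> [[mu_ uoo]|[mu_ iu]]; split => //.
  apply: ge0_rintegrable => //.
    apply: measurable_funM; first exact: measurable_weight.
    exact: measurable_funX.
  by move=> X _; rewrite mulr_ge0 ?powR_ge0 ?sqr_ge0.
by rewrite rintegrable_fin// ltry.
Qed.

(** Domination by [|u v| <= u^2 + v^2], multiplied by the weight. *)
Lemma weighted_L2M_integrable u v : weighted_L2 a u -> weighted_L2 a v ->
  integrable (fun X => ypart X `^ a * (u X * v X)).
Proof.
move=> /weighted_L2P[mu_ iu] /weighted_L2P[mv iv].
apply: (rintegrable_le mD _ _ (rintegrableD mD iu iv)).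
  apply: measurable_funM; first exact: measurable_weight.
  exact: measurable_funM.
move=> X _; rewrite normrM ger0_norm ?powR_ge0// -mulrDr.
rewrite ler_wpM2l ?powR_ge0// ler_norml.
by apply/andP; split; nra.
Qed.

Lemma weighted_L2_bounded_mul (M : R) h u : measurable_fun D h ->
  (forall X, D X -> `|h X| <= M) -> weighted_L2 a u ->
  weighted_L2 a (fun X => h X * u X).
Proof.
move=> mh hM /weighted_L2P[mu_ iu]; apply/weighted_L2P; split.
  exact: measurable_funM.
apply: (rintegrable_le mD _ _ (rintegrableZl mD (M ^+ 2) iu)).
  apply: measurable_funM; first exact: measurable_weight.
  by apply: measurable_funX; exact: measurable_funM.
move=> X DX; rewrite ger0_norm; last by rewrite mulr_ge0 ?powR_ge0 ?sqr_ge0.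
rewrite exprMn mulrCA ler_wpM2r//.
  by rewrite mulr_ge0 ?powR_ge0 ?sqr_ge0.
by rewrite -real_normK ?num_real// ler_sqr ?nnegrE// ?hM// (le_trans _ (hM X DX)).
Qed.

Lemma weighted_L2D u v : weighted_L2 a u -> weighted_L2 a v ->
  weighted_L2 a (fun X => u X + v X).
Proof.
move=> Lu Lv; have iuv := weighted_L2M_integrable Lu Lv.
move: Lu Lv => /weighted_L2P[mu_ iu] /weighted_L2P[mv iv].
apply/weighted_L2P; split; first exact: measurable_funD.
have := rintegrableD mD (rintegrableD mD iu (rintegrableZl mD 2 iuv)) iv.
apply: eq_integrable => // X _ /=; congr EFin; ring.
Qed.

Lemma weighted_L2_0 : weighted_L2 a (fun _ : Rn1 => 0).
Proof.
apply/weighted_L2P; split; first exact: measurable_cst.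
under [X in EFin \o X]eq_fun do rewrite expr0n mulr0.
exact: integrable0.
Qed.

Lemma weighted_L2_sum I (s : seq I) (u : I -> Rn1 -> R) :
  (forall i, weighted_L2 a (u i)) -> weighted_L2 a (fun X => \sum_(i <- s) u i X).
Proof.
move=> Lu; elim: s => [|i s IH].
  by under eq_fun do rewrite big_nil; exact: weighted_L2_0.
by under eq_fun do rewrite big_cons; exact: weighted_L2D.
Qed.

Lemma eq_weighted_L2 u v : {in D, u =1 v} -> weighted_L2 a u -> weighted_L2 a v.
Proof.
move=> uv [mu_ uoo]; split; first exact: eq_measurable_fun mu_.
by under eq_integral do rewrite -uv//.
Qed.

Lemma dotv_integrable (G H : Rn1 -> Rn1) :
  (forall i, weighted_L2 a (fun X => G X ord0 i)) ->
  (forall i, weighted_L2 a (fun X => H X ord0 i)) ->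
  integrable (fun X => ypart X `^ a * dotv (G X) (H X)).
Proof.
move=> LG LH; rewrite /dotv; under [X in EFin \o X]eq_fun do rewrite mulr_sumr.
by apply: rintegrable_sum => // i; exact: weighted_L2M_integrable.
Qed.

Hypothesis a_le1 : a <= 1.

(* The weight is bounded below on compact subsets of the open half cylinder. *)
Lemma ypart_le_weight X : D X -> ypart X <= ypart X `^ a.
Proof.
move=> [_ /andP[y0 y1]]; rewrite -[leLHS]powRr1; last exact: ltW.
by apply: ger_powR => //; rewrite y0 ltW.
Qed.

(** Passes from weighted to unweighted integrability. If [y >= c > 0] on [K], then
    [|u| <= 1 + u^2 <= 1 + y^a u^2 / c] there, and the constant 1 is integrable because the cylinder
    has finite measure. *)
Lemma compact_supp_integrable (K : set Rn1) h u : compact K -> K `<=` D ->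
  continuous h -> (forall X, ~ K X -> h X = 0) -> weighted_L2 a u ->
  integrable (fun X => u X * h X).
Proof.
move=> cK KD ch h0 /weighted_L2P[mu_ iu].
(* [c] is the minimum of [y] on [K], positive because [K] lies in the open cylinder. *)
have [c c0 cy] : exists2 c, 0 < c & forall X, K X -> c <= ypart X.
  have [->|/set0P K0] := eqVneq K set0; first by exists 1.
  have [Z KZ Zmin] := EVT_min_rV K0 cK
    (continuous_subspaceT (@ypart_continuous R n)).
  exists (ypart Z) => [|X KX]; last by apply: Zmin; rewrite inE.
  by have [_ /andP[]] := KD _ (set_mem KZ).
have [M M0 hM] := continuous_compact_bounded ch cK.
have i1 := rintegrable_cst mD 1 (@lebesgue_half_cylinder_fin R n).
have := rintegrableZl mD M (rintegrableD mD i1 (rintegrableZl mD c^-1 iu)).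
apply: rintegrable_le => //.
  apply: measurable_funM => //; apply: measurable_funTS.
  exact: continuous_measurable_rV.
move=> X DX; have w0 : 0 <= c^-1 * (ypart X `^ a * u X ^+ 2).
  by rewrite mulr_ge0 ?invr_ge0 ?(ltW c0)// mulr_ge0 ?powR_ge0 ?sqr_ge0.
have [KX|KX] := pselect (K X); last first.
  by rewrite h0// mulr0 normr0 mulr_ge0// addr_ge0.
rewrite normrM mulrC ler_pM ?hM//.
have uu : `|u X| <= 1 + u X ^+ 2 by rewrite ler_norml; apply/andP; split; nra.
apply: (le_trans uu); rewrite lerD2l -ler_pdivrMl ?invr_gt0// invrK.
by rewrite ler_wpM2r ?sqr_ge0// (le_trans (cy X KX))// ypart_le_weight.
Qed.

End weighted_L2.

(** * Multiplication of H^1 functions by smooth functions *)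

Section dotv_facts.
Context {R : realType} {m : nat}.
Implicit Types u v : 'rV[R]_m.

Lemma dotv_ge0 u : 0 <= dotv u u.
Proof. by rewrite sumr_ge0// => i _; rewrite -expr2 sqr_ge0. Qed.

(** Parallelogram identity: the two sides differ by [|s u - t v|^2]. *)
Lemma dotv_lincomb_le (s t : R) u v : dotv (s *: u + t *: v) (s *: u + t *: v) <=
  2 * s ^+ 2 * dotv u u + 2 * t ^+ 2 * dotv v v.
Proof.
rewrite /dotv !mulr_sumr -big_split/=; apply: ler_sum => i _.
rewrite !mxE -subr_ge0.
rewrite [leRHS](_ : _ = (s * u ord0 i - t * v ord0 i) ^+ 2) ?sqr_ge0//; ring.
Qed.

Lemma measurable_dotv d (T : measurableType d) (E : set T) (G H : T -> 'rV[R]_m) :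
  (forall i, measurable_fun E (fun X => G X ord0 i)) ->
  (forall i, measurable_fun E (fun X => H X ord0 i)) ->
  measurable_fun E (fun X => dotv (G X) (H X)).
Proof. by move=> mG mH; apply: measurable_sum => i; exact: measurable_funM. Qed.

Lemma gradient_dotv_continuous (p : 'rV[R]_m -> R) : smooth p ->
  continuous (fun X => dotv (gradient p X) (gradient p X)).
Proof.
move=> sp; apply: continuous_big => [|i _]; first exact: add_continuous.
by move=> X; apply: continuousM; exact: gradient_continuous.
Qed.

Lemma measurable_gradient (p : 'rV[R]_m -> R) i : smooth p ->
  measurable_fun setT (fun X => gradient p X ord0 i).
Proof.
by move=> sp; apply: continuous_measurable_rV; exact: gradient_continuous.
Qed.

Lemma gradient_off_support (K : set 'rV[R]_m) (phi : 'rV[R]_m -> R) X :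
  closed K -> (forall Y, ~ K Y -> phi Y = 0) -> ~ K X -> gradient phi X = 0.
Proof.
move=> cK phi0 nKX; rewrite (@near_eq_gradient _ _ _ (fun=> 0)).
  by apply/rowP => i; rewrite !mxE derive_cst.
have : nbhs X (~` K) by apply: open_nbhs_nbhs; split => //; exact: closed_openC.
by apply: filterS => Y; exact: phi0.
Qed.

Lemma test_functionM (E : set 'rV[R]_m) p phi :
  smooth p -> test_function E phi -> test_function E (p * phi).
Proof.
move=> sp [sphi [K [cK KE phi0]]]; split; first exact: smoothM.
exists K; split => // X nKX; rewrite -[LHS]/(p X * phi X).
by rewrite phi0// mulr0.
Qed.

End dotv_facts.

Lemma cvge0_le_mul (R : realType) (C : R) (I J : nat -> \bar R) :
  (forall k, 0 <= J k <= C%:E * I k)%E -> (I k @[k --> \oo] --> 0)%E ->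
  (J k @[k --> \oo] --> 0)%E.
Proof.
move=> IJ I0; apply: (@squeeze_cvge _ _ _ _ (fun=> 0%E) _ (fun k => C%:E * I k)%E).
- by apply: nearW.
- exact: cvg_cst.
- by rewrite -(mule0 C%:E); exact: cvgeZl.
Qed.

Section smooth_multiplier.
Context {R : realType} {n : nat} (a : R).
Local Notation Rn := 'rV[R]_n.
Local Notation Rn1 := 'rV[R]_(n + 1).
Local Notation D := (half_cylinder n : set Rn1).
Local Notation mu := (lebesgue_rV R (n + 1)).
Local Notation B1 := (unit_ball n : set Rn).
Implicit Types (U p : Rn1 -> R) (DU : Rn1 -> Rn1).

Definition mul_gradient p U DU : Rn1 -> Rn1 :=
  fun X => p X *: DU X + U X *: gradient p X.

Let mD : measurable D := measurable_half_cylinder.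

Lemma smooth_bounded_half_cylinder p : smooth p ->
  exists2 M, 0 <= M & forall X, closure D X -> `|p X| <= M.
Proof.
move=> /smooth_continuous cp.
exact: continuous_compact_bounded cp compact_closure_half_cylinder.
Qed.

Lemma gradient_bounded_half_cylinder p i : smooth p ->
  exists M, forall X, D X -> `|gradient p X ord0 i| <= M.
Proof.
move=> /(@gradient_continuous _ _ _ i) cp.
have [M _ pM] := continuous_compact_bounded cp compact_closure_half_cylinder.
by exists M => X DX; apply: pM; exact: subset_closure.
Qed.

Lemma smooth_measurable p : smooth p -> measurable_fun D p.
Proof.
move=> /smooth_continuous cp.
by apply: measurable_funTS; exact: continuous_measurable_rV.
Qed.

Lemma weighted_L2_smooth_mul p U : smooth p -> weighted_L2 a U ->
  weighted_L2 a (fun X => p X * U X).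
Proof.
move=> sp; have [M _ pM] := smooth_bounded_half_cylinder sp.
apply: (@weighted_L2_bounded_mul _ _ _ M); first exact: smooth_measurable.
by move=> X DX; apply: pM; exact: subset_closure.
Qed.

Lemma weighted_L2_gradient_mul p U i : smooth p -> weighted_L2 a U ->
  weighted_L2 a (fun X => U X * gradient p X ord0 i).
Proof.
move=> sp LU; have [M pM] := gradient_bounded_half_cylinder i sp.
under eq_fun do rewrite mulrC.
apply: (@weighted_L2_bounded_mul _ _ _ M) => //.
by apply: measurable_funTS; exact: measurable_gradient.
Qed.

Lemma weighted_L2_mul_gradient p U DU : smooth p -> weighted_L2 a U ->
  (forall i, weighted_L2 a (fun X => DU X ord0 i)) ->
  forall i, weighted_L2 a (fun X => mul_gradient p U DU X ord0 i).
Proof.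
move=> sp LU LDU i; under eq_fun do rewrite !mxE.
apply: weighted_L2D; first exact: weighted_L2_smooth_mul.
have := weighted_L2_gradient_mul i sp LU.
by under eq_fun do rewrite mxE.
Qed.

(** [p phi] is again a test function. Testing [DU] with it and expanding its gradient produces the
    wanted integral of [p U grad phi] together with that of [U phi grad p], which moves to the other
    side as the second term of [mul_gradient]. *)
Lemma weak_gradientM p U DU : a <= 1 -> smooth p -> weighted_L2 a U ->
  (forall i, weighted_L2 a (fun X => DU X ord0 i)) ->
  weak_gradient U DU ->
  weak_gradient (fun X => p X * U X) (mul_gradient p U DU).
Proof.
move=> a1 sp LU LDU wU phi tphi i.
have [sphi [K [cK KD phi0]]] := tphi.
have clK : closed K by apply: compact_closed => //; exact: norm_hausdorff.
have cp := smooth_continuous sp; have cphi := smooth_continuous sphi.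
have cgp := gradient_continuous (i := i) sp.
have cgphi := gradient_continuous (i := i) sphi.
have gphi0 X : ~ K X -> gradient phi X ord0 i = 0.
  by move=> nKX; rewrite (gradient_off_support clK phi0 nKX) mxE.
have i1 : mu.-integrable D (EFin \o (fun X => U X * (p X * gradient phi X ord0 i))).
  apply: (compact_supp_integrable a1 cK KD) => //.
    by move=> X; apply: continuousM; [exact: cp|exact: cgphi].
  by move=> X nKX; rewrite gphi0// mulr0.
have i2 : mu.-integrable D (EFin \o (fun X => U X * (phi X * gradient p X ord0 i))).
  apply: (compact_supp_integrable a1 cK KD) => //.
    by move=> X; apply: continuousM; [exact: cphi|exact: cgp].
  by move=> X nKX; rewrite phi0// mul0r.
have i3 : mu.-integrable D (EFin \o (fun X => DU X ord0 i * (p X * phi X))).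
  apply: (compact_supp_integrable a1 cK KD (u := fun X => DU X ord0 i)) => //.
    by move=> X; apply: continuousM; [exact: cp|exact: cphi].
  by move=> X nKX; rewrite phi0// mulr0.
have := wU _ (test_functionM sp tphi) i.
rewrite (@eq_Rintegral _ _ _ mu _ (fun X => U X * (p X * gradient phi X ord0 i) +
  U X * (phi X * gradient p X ord0 i))); last first.
  by move=> X _; rewrite gradientM// [in LHS]mxE [in X in _ * (X + _)]mxE
    [in X in _ * (_ + X)]mxE mulrDr.
rewrite RintegralD// => /eqP; rewrite eq_sym -subr_eq => /eqP e.
rewrite (@eq_Rintegral _ _ _ mu _
  (fun X => U X * (p X * gradient phi X ord0 i))); last first.
  by move=> X _; ring.
rewrite -e -opprD; congr (- _); rewrite -RintegralD//.
apply: eq_Rintegral => X _.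
rewrite /mul_gradient [in RHS]mxE [in X in (X + _) * _]mxE [in X in (_ + X) * _]mxE.
rewrite -[(p * phi) X]/(p X * phi X); ring.
Qed.

Lemma in_H1M p U DU : a <= 1 -> smooth p -> in_H1 a U DU ->
  in_H1 a (fun X => p X * U X) (mul_gradient p U DU).
Proof.
move=> a1 sp [LU LDU wU]; split.
- exact: weighted_L2_smooth_mul.
- exact: weighted_L2_mul_gradient.
- exact: weak_gradientM.
Qed.

Lemma smooth_on_closureM p phi : smooth p -> smooth_on (closure D) phi ->
  smooth_on (closure D) (fun X => p X * phi X).
Proof.
move=> sp [g sg phig]; exists (p * g); first exact: smoothM.
by move=> X DX; rewrite phig.
Qed.

(** Off the closure [phi] is arbitrary, so values may be compared up to the boundary but gradients
    only inside. *)
Lemma smooth_onE phi : smooth_on (closure D) phi ->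
  exists g, [/\ smooth g, forall X, closure D X -> phi X = g X &
    forall X, D X -> gradient phi X = gradient g X].
Proof.
move=> [g sg phig]; exists g; split => // X DX; first by apply: phig; rewrite inE.
apply: (gradient_eq_open (@open_half_cylinder _ _)) => // Y YD.
by apply: phig; rewrite inE; apply: subset_closure; exact: set_mem.
Qed.

(** With [e = phi_k - U] and [E = grad phi_k - DU], the new errors are [p e] and [p E + e grad p];
    both are controlled pointwise by the old ones. *)
Lemma cvg_H1M p U DU phi : smooth p -> in_H1 a U DU -> cvg_H1 a phi U DU ->
  cvg_H1 a (fun k X => p X * phi k X) (fun X => p X * U X) (mul_gradient p U DU).
Proof.
move=> sp [[mU _] LDU _] [sphi phiU].
split=> [k|]; first exact: smooth_on_closureM.
have [M M0 pM] := smooth_bounded_half_cylinder sp.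
have [N N0 gN] := continuous_compact_bounded (gradient_dotv_continuous sp)
  compact_closure_half_cylinder.
have mDU i : measurable_fun D (fun X => DU X ord0 i) by have [] := LDU i.
have mgp i : measurable_fun D (fun X => gradient p X ord0 i).
  by apply: measurable_funTS; exact: measurable_gradient.
have mp := smooth_measurable sp.
(* [M] bounds [|p|] and [N] bounds [|grad p|^2]; the factors 2 come from [dotv_lincomb_le]. *)
apply: (cvge0_le_mul (C := 2 * M ^+ 2 + 2 * N)) phiU => k.
have [h [sh phih gphih]] := smooth_onE (sphi k).
have clD X : D X -> closure D X by exact: subset_closure.
have mh := smooth_measurable sh.
have mphi : measurable_fun D (phi k).
  by apply: eq_measurable_fun mh => X /set_mem DX; rewrite phih//; exact: clD.
have mgphi i : measurable_fun D (fun X => gradient (phi k) X ord0 i).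
  apply: (eq_measurable_fun (fun X => gradient h X ord0 i)).
    by move=> X /set_mem DX; rewrite gphih.
  by apply: measurable_funTS; exact: measurable_gradient.
have gpphi X : D X -> gradient (fun X => p X * phi k X) X - mul_gradient p U DU X =
    p X *: (gradient (phi k) X - DU X) + (phi k X - U X) *: gradient p X.
  move=> DX; rewrite (gradient_eq_open (g := p * h) (@open_half_cylinder _ _))//.
    rewrite gradientM// gphih// phih; last exact: clD.
    by apply/rowP => i; rewrite !mxE; ring.
  by move=> Y /set_mem DY; rewrite phih//; exact: clD.
apply/andP; split.
  apply: integral_ge0 => X _.
  by rewrite lee_fin mulr_ge0 ?powR_ge0// addr_ge0 ?sqr_ge0.
have me : measurable_fun D (fun X => phi k X - U X) by exact: measurable_funB.
have mE i : measurable_fun D (fun X => (gradient (phi k) X - DU X) ord0 i).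
  under eq_fun do rewrite mxE [X in _ + X]mxE.
  by apply: measurable_funB.
have mR : measurable_fun D (fun X => ypart X `^ a * ((phi k X - U X) ^+ 2 +
    enorm (gradient (phi k) X - DU X) ^+ 2)).
  apply: measurable_funM; first exact: measurable_weight.
  apply: measurable_funD; first exact: measurable_funX.
  by under eq_fun do rewrite enorm2; exact: measurable_dotv.
rewrite -ge0_integralZl//; last 3 first.
- exact/measurable_EFinP.
- by move=> X _; rewrite lee_fin mulr_ge0 ?powR_ge0// addr_ge0 ?sqr_ge0.
- by rewrite lee_fin addr_ge0// mulr_ge0// sqr_ge0.
apply: ge0_le_integral => //.
- by move=> X _; rewrite lee_fin mulr_ge0 ?powR_ge0// addr_ge0 ?sqr_ge0.
- apply/measurable_EFinP; apply: measurable_funM; first exact: measurable_weight.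
  apply: measurable_funD.
    by apply: measurable_funX; apply: measurable_funB; exact: measurable_funM.
  under eq_fun do rewrite enorm2.
  apply: (eq_measurable_fun (fun X => dotv
    (p X *: (gradient (phi k) X - DU X) + (phi k X - U X) *: gradient p X)
    (p X *: (gradient (phi k) X - DU X) + (phi k X - U X) *: gradient p X))).
    by move=> X /set_mem DX; rewrite gpphi.
  have mT i : measurable_fun D (fun X => (p X *: (gradient (phi k) X - DU X) +
      (phi k X - U X) *: gradient p X) ord0 i).
    under eq_fun do rewrite mxE [X in X + _]mxE [X in _ + X]mxE.
    by apply: measurable_funD; apply: measurable_funM.
  exact: measurable_dotv.
- by apply: measurable_funeM; exact/measurable_EFinP.
move=> X DX; rewrite -EFinM lee_fin mulrCA ler_wpM2l ?powR_ge0//.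
rewrite gpphi// !enorm2.
set e := phi k X - U X; set E := gradient (phi k) X - DU X.
have -> : (p X * phi k X - p X * U X) ^+ 2 = p X ^+ 2 * e ^+ 2 by rewrite /e; ring.
have {}pM : p X ^+ 2 <= M ^+ 2.
  by rewrite -real_normK ?num_real// ler_sqr ?nnegrE// pM//; exact: clD.
have {}gN : dotv (gradient p X) (gradient p X) <= N.
  by rewrite (le_trans (ler_norm _))// gN//; exact: clD.
have E0 := dotv_ge0 E; have e0 := sqr_ge0 e.
have := dotv_lincomb_le (p X) e E (gradient p X).
have h1 : p X ^+ 2 * e ^+ 2 <= M ^+ 2 * e ^+ 2 by rewrite ler_wpM2r.
have h2 : p X ^+ 2 * dotv E E <= M ^+ 2 * dotv E E by rewrite ler_wpM2r.
have h3 : e ^+ 2 * dotv (gradient p X) (gradient p X) <= e ^+ 2 * N.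
  by rewrite ler_wpM2l.
have h4 : 0 <= N * dotv E E by rewrite mulr_ge0.
have h5 : 0 <= M ^+ 2 * e ^+ 2 by rewrite mulr_ge0 ?sqr_ge0.
rewrite mulrDr !mulrDl; lra.
Qed.

(** The approximations [phi] may have any boundary values: the factor [p] kills them. *)
Lemma zero_on_outer_boundaryM p U DU phi : smooth p -> in_H1 a U DU ->
  cvg_H1 a phi U DU -> (forall X, outer_boundary n X -> p X = 0) ->
  zero_on_outer_boundary a (fun X => p X * U X) (mul_gradient p U DU).
Proof.
move=> sp HU phiU p0; exists (fun k X => p X * phi k X); first exact: cvg_H1M.
by move=> k X /p0 ->; rewrite mul0r.
Qed.

Lemma is_traceM p U DU (U0 : Rn -> R) : smooth p ->
  in_H1 a U DU -> is_trace a U DU U0 ->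
  is_trace a (fun X => p X * U X) (mul_gradient p U DU)
    (fun x => p (base_point x) * U0 x).
Proof.
move=> sp HU [mU0 [phi phiU phi0]].
have mcomp q : smooth q -> measurable_fun B1 (fun x => q (base_point x)).
  move=> sq; apply: measurable_funTS.
  apply: (measurableT_comp _ measurable_base_point).
  by apply: continuous_measurable_rV; exact: smooth_continuous.
split; first by apply: measurable_funM => //; exact: mcomp.
exists (fun k X => p X * phi k X); first exact: cvg_H1M.
have [M M0 pM] := smooth_bounded_half_cylinder sp.
apply: (cvge0_le_mul (C := M ^+ 2)) phi0 => k.
have mphi : measurable_fun B1 (fun x => phi k (base_point x)).
  have [h [sh phih _]] := smooth_onE (phiU.1 k).
  apply: eq_measurable_fun (mcomp _ sh) => x /set_mem Bx.
  by rewrite phih//; exact: closure_base_point.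
have mB : measurable B1 by exact: measurable_unit_ball.
have ge0 x : B1 x -> (0 <= ((phi k (base_point x) - U0 x) ^+ 2)%:E)%E.
  by rewrite lee_fin sqr_ge0.
apply/andP; split; first by apply: integral_ge0 => x _; rewrite lee_fin sqr_ge0.
have mR : measurable_fun B1 (fun x => (phi k (base_point x) - U0 x) ^+ 2).
  by apply: measurable_funX; exact: measurable_funB.
rewrite -ge0_integralZl//; [|exact/measurable_EFinP|by rewrite lee_fin sqr_ge0].
apply: ge0_le_integral => //.
- by move=> x _; rewrite lee_fin sqr_ge0.
- apply/measurable_EFinP; apply: measurable_funX.
  by apply: measurable_funB; apply: measurable_funM => //; exact: mcomp.
- by apply: measurable_funeM; exact/measurable_EFinP.
move=> x Bx; rewrite -EFinM lee_fin -mulrBr exprMn ler_wpM2r ?sqr_ge0//.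
rewrite -real_normK ?num_real// ler_sqr ?nnegrE//.
by apply: pM; exact: closure_base_point.
Qed.

End smooth_multiplier.

(** * Coercivity of the block matrix *)

Section bilinear_form.
Context {R : realType} {m : nat}.
Implicit Types (u v w G : 'rV[R]_m) (M : 'M[R]_m).

Lemma dotvE u v : dotv u v = (u *m v^T) ord0 ord0.
Proof. by rewrite mxE; apply: eq_bigr => i _; rewrite [v^T _ _]mxE. Qed.

Lemma mulmvE M u : mulmv M u = u *m M^T.
Proof. by rewrite /mulmv trmx_mul trmxK. Qed.

Lemma dotvC u v : dotv u v = dotv v u.
Proof. by apply: eq_bigr => i _; rewrite mulrC. Qed.

Lemma dotvDl u v w : dotv (u + v) w = dotv u w + dotv v w.
Proof. by rewrite !dotvE mulmxDl mxE. Qed.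

Lemma dotvZl (k : R) u v : dotv (k *: u) v = k * dotv u v.
Proof. by rewrite !dotvE -scalemxAl mxE. Qed.

Lemma dotvDr u v w : dotv w (u + v) = dotv w u + dotv w v.
Proof. by rewrite !(dotvC w) dotvDl. Qed.

Lemma dotvZr (k : R) u v : dotv u (k *: v) = k * dotv u v.
Proof. by rewrite !(dotvC u) dotvZl. Qed.

Lemma mulmvD M u v : mulmv M (u + v) = mulmv M u + mulmv M v.
Proof. by rewrite !mulmvE mulmxDl. Qed.

Lemma mulmvZ M (k : R) u : mulmv M (k *: u) = k *: mulmv M u.
Proof. by rewrite !mulmvE scalemxAl. Qed.

Lemma mulmv_coord M u i : mulmv M u ord0 i = \sum_j M i j * u ord0 j.
Proof. by rewrite mxE mxE; apply: eq_bigr => j _; rewrite [u^T _ _]mxE. Qed.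

Lemma dotv_mulmv_sym M u v : M^T = M -> dotv (mulmv M u) v = dotv (mulmv M v) u.
Proof.
move=> symM; rewrite (dotvC (mulmv M v)) !dotvE !mulmvE trmx_mul trmxK symM.
by rewrite mulmxA.
Qed.

(* Expanding [q (v + 2 w) >= 0], with [q] the quadratic form of [M], gives
   [q v + 2 b (v, w) >= q v / 2 - 2 q w], which replaces Cauchy-Schwarz. *)
Lemma coercivity M (l L : R) v w G : M^T = M -> 0 < l ->
  (forall u, l * dotv u u <= dotv (mulmv M u) u <= L * dotv u u) ->
  l / 4 * dotv v v <= dotv (mulmv M v) (v + 2 *: w) - dotv G (v + 2 *: w) +
    (2 * L + 2 + l^-1) * (dotv w w + dotv G G).
Proof.
move=> symM l0 ellM.
have /andP[qv _] := ellM v; have /andP[qw0 qw] := ellM w.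
have /andP[qvw _] := ellM (v + 2 *: w).
have := dotv_ge0 (v + 2 *: w).
have li0 : 0 < l^-1 by rewrite invr_gt0.
have ww := dotv_ge0 w; have GG := dotv_ge0 G; have vv := dotv_ge0 v.
have {qvw} : 0 <= dotv (mulmv M (v + 2 *: w)) (v + 2 *: w).
  by rewrite (le_trans _ qvw)// mulr_ge0 ?dotv_ge0// ltW.
rewrite mulmvD mulmvZ !dotvDl !dotvDr !dotvZl !dotvZr (dotv_mulmv_sym _ _ symM).
move=> qvw _.
(* This square yields [2 G.w <= |w|^2 + |G|^2]. *)
have Gw := dotv_ge0 (G + (-1) *: w); rewrite !dotvDl !dotvDr !dotvZl !dotvZr in Gw.
(* The weight [l / 2] makes [G.v] cost only [l / 4 |v|^2], half of the [l / 2 |v|^2] available from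
   [q v / 2]. *)
have Gv := dotv_ge0 (G + (- (l / 2)) *: v).
rewrite !dotvDl !dotvDr !dotvZl !dotvZr in Gv.
rewrite (dotvC w G) in Gw; rewrite (dotvC v G) in Gv.
have {}Gv : dotv G v <= l^-1 * dotv G G + l / 4 * dotv v v.
  rewrite -subr_ge0 (_ : _ - _ = l^-1 * (dotv G G + - (l / 2) * dotv G v +
    (- (l / 2) * dotv G v + - (l / 2) * (- (l / 2) * dotv v v)))).
    by rewrite mulr_ge0// ltW.
  by field; exact: lt0r_neq0.
have L0 : 0 <= L * dotv w w.
  by rewrite (le_trans _ qw)// (le_trans _ qw0)// mulr_ge0// ltW.
have lw : 0 <= l^-1 * dotv w w by rewrite mulr_ge0// ltW.
(* As [|w|^2] and [|G|^2] share one constant, [2 L |G|^2] is left over; its sign is read off from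
   ellipticity at [G], since none is assumed for [L]. *)
have LG : 0 <= L * dotv G G.
  have [->|] := eqVneq (dotv G G) 0; first by rewrite mulr0.
  move=> G0; have /andP[h1 h2] := ellM G.
  by rewrite (le_trans _ h2)// (le_trans _ h1)// mulr_ge0// ltW.
nra.
Qed.

End bilinear_form.

Section block_matrix.
Context {R : realType} {n : nat}.
Implicit Types (A : 'M[R]_n) (X Y : 'rV[R]_(n + 1)).

Lemma dotv_parts X Y : dotv X Y = dotv (xpart X) (xpart Y) + ypart X * ypart Y.
Proof.
rewrite /dotv big_split_ord big_ord1/= !ypartE; congr (_ + _).
by apply: eq_bigr => i _; rewrite !xpartE.
Qed.

Lemma block_mx_form A X :
  dotv (mulmv (block_mx A 0 0 1%:M) X) X =
  dotv (mulmv A (xpart X)) (xpart X) + ypart X ^+ 2.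
Proof.
have -> : mulmv (block_mx A 0 0 1%:M) X = row_mx (mulmv A (xpart X)) (rsubmx X).
  rewrite !mulmvE tr_block_mx !trmx0 trmx1 -[in LHS](hsubmxK X) mul_row_block.
  by rewrite !mulmx0 addr0 add0r mulmx1.
by rewrite dotv_parts /xpart row_mxKl /ypart row_mxKr expr2.
Qed.

(** The last diagonal entry contributes exactly the square of the last coordinate, whence the
    comparison of both constants with 1. *)
Lemma block_mx_elliptic A (L1 L2 : R) :
  (forall xi : 'rV[R]_n,
    L1 * enorm xi ^+ 2 <= dotv (mulmv A xi) xi <= L2 * enorm xi ^+ 2) ->
  forall X, Num.min L1 1 * dotv X X <= dotv (mulmv (block_mx A 0 0 1%:M) X) X
    <= Num.max L2 1 * dotv X X.
Proof.
move=> ellA X; rewrite block_mx_form dotv_parts -expr2 !mulrDr.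
have := ellA (xpart X); rewrite enorm2 => /andP[A1 A2].
apply/andP; split; apply: lerD.
- by rewrite (le_trans _ A1)// ler_wpM2r ?dotv_ge0// ge_min lexx.
- by rewrite -[leRHS]mul1r ler_wpM2r ?sqr_ge0// ge_min lexx orbT.
- by rewrite (le_trans A2)// ler_wpM2r ?dotv_ge0// le_max lexx.
- by rewrite -[leLHS]mul1r ler_wpM2r ?sqr_ge0// le_max lexx orbT.
Qed.

Lemma block_mx_sym A : A^T = A ->
  (block_mx A 0 0 1%:M : 'M[R]_(n + 1))^T = block_mx A 0 0 1%:M.
Proof. by move=> symA; rewrite tr_block_mx symA !trmx0 trmx1. Qed.

(** Bounded measurable entries keep the product of the matrix with [DU] in the weighted [L^2], so
    that the energy integrand is integrable. *)
Lemma block_matrix_bounded (A : 'rV[R]_n -> 'M[R]_n) (L1 L2 : R) :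
  elliptic_matrix L1 L2 A -> forall i j, exists2 M,
    measurable_fun (half_cylinder n) (fun X => block_matrix A (xpart X) i j) &
    forall X, half_cylinder n X -> `|block_matrix A (xpart X) i j| <= M.
Proof.
move=> [_ mA [M AM] _] i j; rewrite -(splitK i) -(splitK j) /block_matrix.
case: (fintype.split i) => i'; case: (fintype.split j) => j' /=.
- exists M => [|X [Bx _]].
    under eq_fun do rewrite block_mxEul.
    have sub : @xpart R n @` half_cylinder n `<=` unit_ball n.
      by move=> _ [X [Bx _] <-].
    exact: (measurable_comp measurable_unit_ball sub (mA i' j')
      (measurable_funTS measurable_xpart)).
  by rewrite block_mxEul AM.
- exists 0 => [|X _]; last by rewrite block_mxEur mxE normr0.
  by under eq_fun do rewrite block_mxEur mxE; exact: measurable_cst.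
- exists 0 => [|X _]; last by rewrite block_mxEdl mxE normr0.
  by under eq_fun do rewrite block_mxEdl mxE; exact: measurable_cst.
- exists `|(1%:M : 'M[R]_1) i' j'| => [|X _]; last by rewrite block_mxEdr.
  by under eq_fun do rewrite block_mxEdr; exact: measurable_cst.
Qed.

End block_matrix.

(** * The energy estimate *)

Section energy_estimate.
Context {R : realType} {n : nat}.
Variables (L1 L2 a : R) (A : 'rV[R]_n -> 'M[R]_n).
Variables (F : 'rV[R]_(n + 1) -> 'rV[R]_(n + 1)) (f : 'rV[R]_n -> R).
Variables (U : 'rV[R]_(n + 1) -> R) (DU : 'rV[R]_(n + 1) -> 'rV[R]_(n + 1)).
Variables (U0 : 'rV[R]_n -> R) (eta : 'rV[R]_(n + 1) -> R).
Hypotheses (L1_gt0 : 0 < L1) (a_le1 : a <= 1) (ellA : elliptic_matrix L1 L2 A).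
Hypothesis F_L2 : forall i, weighted_L2 a (fun X => F X ord0 (lshift 1 i)).
Hypothesis F_y0 : forall X, half_cylinder n X -> ypart (F X) = 0.
Hypotheses (solU : weak_solution a A F f U DU) (trU : is_trace a U DU U0).
Hypothesis smooth_eta : smooth eta.
Hypothesis eta0 : forall X, outer_boundary n X -> eta X = 0.

Local Notation Rn1 := 'rV[R]_(n + 1).
Local Notation D := (half_cylinder n : set Rn1).
Local Notation B1 := (unit_ball n : set 'rV[R]_n).
Local Notation dX := (lebesgue_rV R (n + 1)).
Local Notation dx := (lebesgue_rV R n).
Local Notation weight X := (ypart X `^ a).

Let l := Num.min L1 1.
Let L := Num.max L2 1.
Let v (X : Rn1) : Rn1 := eta X *: DU X.
Let w (X : Rn1) : Rn1 := U X *: gradient eta X.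
Let G (X : Rn1) : Rn1 := eta X *: F X.
Let psi0 x := eta (base_point x) ^+ 2 * U0 x.

Let mD : measurable D := measurable_half_cylinder.

Let L2U : weighted_L2 a U. Proof. by case: solU => -[]. Qed.

Let L2DU i : weighted_L2 a (fun X => DU X ord0 i).
Proof. by case: solU => -[_ + _] _; exact. Qed.

Let L2F i : weighted_L2 a (fun X => F X ord0 i).
Proof.
rewrite -(splitK i); case: (fintype.split i) => j; first exact: F_L2.
apply: eq_weighted_L2 (weighted_L2_0 a) => X /set_mem DX.
by rewrite /= (ord1 j) -ypartE F_y0.
Qed.

Let L2v i : weighted_L2 a (fun X => v X ord0 i).
Proof. by under eq_fun do rewrite mxE; exact: weighted_L2_smooth_mul. Qed.

Let L2G i : weighted_L2 a (fun X => G X ord0 i).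
Proof. by under eq_fun do rewrite mxE; exact: weighted_L2_smooth_mul. Qed.

Let L2w i : weighted_L2 a (fun X => w X ord0 i).
Proof. by under eq_fun do rewrite mxE; exact: weighted_L2_gradient_mul. Qed.

Let L2BDU i :
  weighted_L2 a (fun X => mulmv (block_matrix A (xpart X)) (DU X) ord0 i).
Proof.
under eq_fun do rewrite mulmv_coord; apply: weighted_L2_sum => j.
have [M mB BM] := block_matrix_bounded ellA i j.
exact: weighted_L2_bounded_mul mB BM _.
Qed.

Let Dpsi := mul_gradient (eta * eta) U DU.

(** The common factor [eta] can be moved to the other argument of each scalar product, turning [DU]
    into [v] and [F] into [G]. *)
Let DpsiE X : Dpsi X = eta X *: (v X + 2 *: w X).
Proof.
rewrite /Dpsi /mul_gradient gradientM// -[(eta * eta) X]/(eta X * eta X).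
by apply/rowP => i; rewrite !mxE; ring.
Qed.

Let L2Dpsi i : weighted_L2 a (fun X => Dpsi X ord0 i).
Proof. by apply: weighted_L2_mul_gradient => //; exact: smoothM. Qed.

Lemma tested_equation :
  dx.-integrable B1 (EFin \o (fun x => psi0 x * f x)) /\
  \int[dX]_(X in D) (weight X *
    dotv (mulmv (block_matrix A (xpart X)) (DU X)) (Dpsi X)) =
  \int[dX]_(X in D) (weight X * dotv (F X) (Dpsi X)) +
  \int[dx]_(x in B1) (psi0 x * f x).
Proof.
have see : smooth (eta * eta) by exact: smoothM.
(* [in_H1] provides only a weak gradient; the smooth approximations of [U] are taken from its
   trace. *)
have [H1U eqU] := solU; have [_ [phi phiU _]] := trU.
apply: (eqU (fun X => (eta * eta) X * U X)).
- exact: in_H1M.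
- apply: (zero_on_outer_boundaryM see H1U phiU) => X /eta0 eX.
  by rewrite -[LHS]/(eta X * eta X) eX mulr0.
- exact: is_traceM.
Qed.

Lemma energy_integrable :
  [/\ dX.-integrable D (EFin \o (fun X => weight X * dotv (v X) (v X))),
      dX.-integrable D (EFin \o (fun X => weight X * dotv (w X) (w X))) &
      dX.-integrable D (EFin \o (fun X => weight X * dotv (G X) (G X)))].
Proof. by split; exact: dotv_integrable. Qed.

Lemma pointwise_energy : {ae dX, forall X, D X ->
  l / 4 * dotv (v X) (v X) <=
  dotv (mulmv (block_matrix A (xpart X)) (DU X)) (Dpsi X) - dotv (F X) (Dpsi X) +
  (2 * L + 2 + l^-1) * (dotv (w X) (w X) + dotv (G X) (G X))}.
Proof.
have [symA _ _ /ae_xpart aeA] := ellA.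
apply: filterS aeA => X ell_X [Bx _]; rewrite DpsiE.
have shift (z z' : Rn1) : dotv z (eta X *: z') = dotv (eta X *: z) z'.
  by rewrite dotvZl dotvZr.
rewrite (shift (mulmv _ _) (v X + _)) (shift (F X) (v X + _)) -mulmvZ.
apply: coercivity; first exact/block_mx_sym/symA.
  by rewrite lt_min L1_gt0 ltr01.
exact/block_mx_elliptic/ell_X.
Qed.

Lemma energy_estimate :
  l / 4 * \int[dX]_(X in D) (weight X * dotv (v X) (v X)) <=
  \int[dx]_(x in B1) (psi0 x * f x) + (2 * L + 2 + l^-1) *
    (\int[dX]_(X in D) (weight X * dotv (w X) (w X)) +
     \int[dX]_(X in D) (weight X * dotv (G X) (G X))).
Proof.
have [iv iw iG] := energy_integrable; have [_ eqB] := tested_equation.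
have iB := dotv_integrable L2BDU L2Dpsi; have iF := dotv_integrable L2F L2Dpsi.
set K := 2 * L + 2 + l^-1.
have iBF := rintegrableB mD iB iF; have iwG := rintegrableD mD iw iG.
have iKwG := rintegrableZl mD K iwG; have ilv := rintegrableZl mD (l / 4) iv.
have i1 := rintegrableD mD iBF iKwG.
(* Once the equation has replaced the boundary term by interior integrals, the claim is the
   nonnegativity of a single integral over [D]. *)
have -> : \int[dx]_(x in B1) (psi0 x * f x) = \int[dX]_(X in D) (weight X *
    dotv (mulmv (block_matrix A (xpart X)) (DU X)) (Dpsi X)) -
  \int[dX]_(X in D) (weight X * dotv (F X) (Dpsi X)).
  by rewrite eqB addrAC subrr add0r.
rewrite -RintegralB// -RintegralD// -RintegralZl// -RintegralZl// -RintegralD//.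
rewrite -subr_ge0 -RintegralB//; apply: ae_Rintegral_ge0 => //.
  exact: (rintegrable_measurable (rintegrableB mD i1 ilv)).
apply: filterS pointwise_energy => X le_X DX; rewrite -mulrBr -mulrDr.
rewrite !(mulrCA _ (weight X)) -mulrDr -mulrBr mulr_ge0 ?powR_ge0//.
by rewrite subr_ge0 le_X.
Qed.

End energy_estimate.

Theorem lemma3p2 (R : realType) (L1 L2 : R) (L1_gt0 : 0 < L1)
    (L1_le_L2 : L1 <= L2) :
  exists C : R, 0 < C /\
  forall (n : nat) (s a : R) (A : 'rV[R]_n -> 'M[R]_n)
    (F : 'rV[R]_(n + 1) -> 'rV[R]_(n + 1)) (f : 'rV[R]_n -> R)
    (U : 'rV[R]_(n + 1) -> R) (DU : 'rV[R]_(n + 1) -> 'rV[R]_(n + 1))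
    (U0 : 'rV[R]_n -> R) (eta : 'rV[R]_(n + 1) -> R),
    (0 < n)%N -> 0 < s < 1 -> a = 1 - 2 * s ->
    elliptic_matrix L1 L2 A ->
    (forall i : 'I_n, weighted_L2 a (fun X => F X ord0 (lshift 1 i))) ->
    (forall X, half_cylinder n X -> ypart (F X) = 0) ->
    measurable_fun (unit_ball n) f ->
    weak_solution a A F f U DU ->
    is_trace a U DU U0 ->
    smooth_on (closure (half_cylinder n)) eta ->
    (forall X, outer_boundary n X -> eta X = 0) ->
    (\int[lebesgue_rV R (n + 1)]_(X in half_cylinder n)
        (ypart X `^ a * eta X ^+ 2 * enorm (DU X) ^+ 2)%:E <=
     C%:E *
     (\int[lebesgue_rV R (n + 1)]_(X in half_cylinder n)
        (ypart X `^ a * (enorm (gradient eta X) ^+ 2 * U X ^+ 2 +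
                         enorm (F X) ^+ 2 * eta X ^+ 2))%:E +
      \int[lebesgue_rV R n]_(x in unit_ball n)
        (eta (base_point x) ^+ 2 * `|U0 x| * `|f x|)%:E))%E.
Proof.
have l0 : 0 < Num.min L1 1 by rewrite lt_min L1_gt0 ltr01.
have L_ge1 : 1 <= Num.max L2 1 by rewrite le_max lexx orbT.
set l := Num.min L1 1 in l0; set L := Num.max L2 1 in L_ge1.
pose K := 2 * L + 2 + l^-1.
have li0 : 0 < l^-1 by rewrite invr_gt0.
(* The boundary term enters the estimate with factor 1, and [K >= 1] lets it share the constant of
   the other terms. *)
have K1 : 1 <= K by rewrite /K; lra.
exists (4 / l * K); split; first by rewrite mulr_gt0 ?divr_gt0//; lra.
move=> n s a A F f U DU U0 eta _ /andP[s0 _] aE ellA FL2 Fy0 mf solU trU.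
move=> eta_smooth eta0.
have a1 : a <= 1 by rewrite aE; lra.
(* The energy estimate is applied to a globally smooth [g] that equals [eta] on the closed cylinder,
   hence also on the outer boundary and at the base points. *)
have [g [sg etag getag]] := smooth_onE eta_smooth.
have clD (X : 'rV[R]_(n + 1)) : half_cylinder n X -> closure (half_cylinder n) X.
  exact: subset_closure.
have g0 (X : 'rV[R]_(n + 1)) : outer_boundary n X -> g X = 0.
  by move=> oX; rewrite -etag ?eta0//; case: oX => -[].
have [iv iw iG] := energy_integrable FL2 Fy0 solU sg.
have [iB _] := tested_equation a1 solU trU sg g0.
have := energy_estimate L1_gt0 a1 ellA FL2 Fy0 solU trU sg g0.
have mD := @measurable_half_cylinder R n; have mB := @measurable_unit_ball R n.
set Iv := \int[_]_(X in _) _; set b := \int[_]_(x in _) _.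
set Iw := \int[_]_(X in _) _; set IG := \int[_]_(X in _) _ => est.
pose b' := \int[lebesgue_rV R n]_(x in unit_ball n)
  `|g (base_point x) ^+ 2 * U0 x * f x|.
have bb' : b <= b'.
  exact: (le_trans (ler_norm _) (le_normr_Rintegral mB iB)).
(* All three extended integrals are finite, the last one because [weak_solution] includes the
   integrability of the tested boundary term; the claim thus becomes an inequality between reals. *)
have -> : (\int[lebesgue_rV R (n + 1)]_(X in half_cylinder n)
    (ypart X `^ a * eta X ^+ 2 * enorm (DU X) ^+ 2)%:E = Iv%:E)%E.
  rewrite -rintegrable_fin//; apply: eq_integral => X /set_mem DX; congr EFin.
  by rewrite etag; [rewrite dotvZl dotvZr enorm2; ring|exact: clD].
have -> : (\int[lebesgue_rV R (n + 1)]_(X in half_cylinder n)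
    (ypart X `^ a * (enorm (gradient eta X) ^+ 2 * U X ^+ 2 +
                     enorm (F X) ^+ 2 * eta X ^+ 2))%:E = (Iw + IG)%:E)%E.
  rewrite -RintegralD// -rintegrable_fin//; last exact: rintegrableD.
  apply: eq_integral => X /set_mem DX; congr EFin.
  rewrite getag// etag; last exact: clD.
  by rewrite !dotvZl !dotvZr !enorm2; ring.
have -> : (\int[lebesgue_rV R n]_(x in unit_ball n)
    (eta (base_point x) ^+ 2 * `|U0 x| * `|f x|)%:E = b'%:E)%E.
  rewrite -rintegrable_fin//; last exact: integrable_norm.
  apply: eq_integral => x /set_mem Bx; congr EFin.
  rewrite etag; last exact: closure_base_point.
  by rewrite (normrM _ (f x)) (normrM _ (U0 x)) ger0_norm ?sqr_ge0.
rewrite -EFinD -EFinM lee_fin.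
have b'0 : 0 <= b' by apply: Rintegral_ge0.
have {est}: l / 4 * Iv <= K * (Iw + IG + b').
  rewrite (le_trans est)// [leRHS]mulrDr [leRHS]addrC lerD2r.
  by rewrite (le_trans bb')// ler_peMl.
move=> est; rewrite (_ : Iv = 4 / l * (l / 4 * Iv)); last first.
  by field; exact: lt0r_neq0.
by rewrite -[leRHS]mulrA ler_wpM2l// divr_ge0// ltW.
Qed.
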